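(* Let $\mathfrak{A}$ be a complete atomic weakly associative relation algebra and let $\mathfrak{B}=\langle B,T_\kappa,E_{\kappa\lambda}\rangle_{\kappa,\lambda<3}$ be the suitable structure of $\mathfrak{A}$. Then there is a set relation algebra $\mathfrak{A}'$ that is a subalgebra of $\mathfrak{Re}(U(\mathfrak{B}))$ such that $\mathfrak{A}\cong\mathfrak{Rl}_{S(\mathfrak{B})}(\mathfrak{A}')$, where $$S(\mathfrak{B})=\{\langle u,v\rangle: u,v\in U(\mathfrak{B}),\ \exists w\ \langle u,v,w\rangle\in V(\mathfrak{B})\}.$$
   Context: Weakly associative relation algebras (WA): an algebra $\mathfrak{A}=\langle A,+,\overline{\phantom{x}},;,\breve{\phantom{x}},1'\rangle$ (binary $+,;$; unary complement $\overline{x}$ and converse $\breve{x}$; constant $1'$), with abbreviations $x\cdot y=\overline{\overline{x}+\overline{y}}$, $0'=\overline{1'}$, $1=1'+0'$, $0=\overline{1}$, is in WA if for all $x,y,z$: $x+y=y+x$; $x+(y+z)=(x+y)+z$; $\overline{\overline{x}+\overline{y}}+\overline{\overline{x}+y}=x$; $((x\cdot 1');1);1=(x\cdot1');1$; $(x+y);z=x;z+y;z$; $x;1'=x$; $\breve{\breve{x}}=x$; $\breve{(x+y)}=\breve{x}+\breve{y}$; $\breve{(x;y)}=\breve{y};\breve{x}$; $\breve{x};\overline{x;y}+\overline{y}=\overline{y}$. $\le$ is the Boolean order; $\mathfrak{A}$ is complete/atomic if its Boolean reduct is; $\mathrm{At}(\mathfrak{A})$ is its set of atoms. Suitable structure of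 an atomic $\mathfrak{A}\in$ WA: $B=\{s\in{}^3\mathrm{At}(\mathfrak{A}): s_2;s_0\ge s_1\}$ (triples $s=\langle s_0,s_1,s_2\rangle$); for $\kappa<3$, $T_\kappa=\{\langle s,t\rangle\in B\times B: s_\kappa=t_\kappa\}$; $E_{\kappa\kappa}=B$; for distinct $\kappa,\lambda<3$ with $\mu$ the third element of $\{0,1,2\}$, $E_{\kappa\lambda}=\{s\in B:s_\mu\le 1'\}$. Trails: a $\mathfrak{B}$-trail is a sequence $p=\langle t_0,\kappa_0,\dots,t_n,\kappa_n\rangle$ with $n\in\omega$, $t_i\in B$, $\kappa_i<3$, and $t_i\ne t_{i+1}$, $\langle t_i,t_{i+1}\rangle\in T_{\kappa_i}$ for all $i<n$; $p$ ends at $t_n$. $\mathrm{Tr}(\mathfrak{B})$ is the set of trails. For $\lambda<3$, $p\lambda=\langle t_0,\kappa_0,\dots,t_{n-1},\kappa_{n-1},t_n,\lambda\rangle$. Let $\approx$ be the smallest equivalence relation on $\mathrm{Tr}(\mathfrak{B})$ such that (whenever the displayed sequences are trails): (a) $\langle t_0,\kappa_0,\dots,t_i,\lambda,s,\lambda,t_i,\kappa_i,\dots,t_n,\kappa_n\rangle\approx\langle t_0,\kappa_0,\dots,t_i,\kappa_i,\dots,t_n,\kappa_n\rangle$ ($0\le i\le n$); (b) $\langle t_0,\kappa_0,\dots,t_n,\lambda,s,\nu\rangle\approx\langle t_0,\kappa_0,\dots,t_n,\nu\rangle$ whenever $\lambda\neq\nu$; (c) $\langle t_0,\kappa_0,\dots,t_n,\lambda\rangle\approx\langle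 t_0,\kappa_0,\dots,t_n,\kappa_n\rangle$ whenever $t_n\in E_{\lambda\kappa_n}$. $p^{\mathfrak{B}}$ is the $\approx$-class of $p$; $U(\mathfrak{B})=\{p^{\mathfrak{B}}:p\in\mathrm{Tr}(\mathfrak{B})\}$; for $t\in B$, $R_t=\{\langle(p0)^{\mathfrak{B}},(p1)^{\mathfrak{B}},(p2)^{\mathfrak{B}}\rangle: p\in\mathrm{Tr}(\mathfrak{B})\text{ ends at }t\}$; $V(\mathfrak{B})=\bigcup_{t\in B}R_t$. $\mathfrak{Re}(U)=\langle\mathcal{P}(U\times U),\cup,U\times U\setminus\cdot,|,{}^{-1},Id_U\rangle$ is the algebra of all binary relations on $U$ (union, complement, relational composition, inverse, identity). A set relation algebra is a subalgebra of some $\mathfrak{Re}(U)$. For a subalgebra $\mathfrak{A}'$ of $\mathfrak{Re}(U)$ and $E\subseteq U\times U$, the relativization $\mathfrak{Rl}_E(\mathfrak{A}')$ has universe $\{R\cap E:R\in A'\}$ and operations $R+S=(R\cup S)\cap E$, $\overline{R}=(U\times U\setminus R)\cap E$, $R;S=(R|S)\cap E$, $\breve{R}=R^{-1}\cap E$, $1'=Id_U\cap E$. *)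

(* Defs.v *)
From Stdlib Require Import List Relations.
Import ListNotations.
Set Implicit Arguments.

Record WA := {
  car : Type;
  wplus : car -> car -> car;
  wcompl : car -> car;
  wsemi : car -> car -> car;
  wconv : car -> car;
  wid : car;
  ax_comm : forall x y, wplus x y = wplus y x;
  ax_assoc : forall x y z, wplus x (wplus y z) = wplus (wplus x y) z;
  ax_huntington : forall x y,
    wplus (wcompl (wplus (wcompl x) (wcompl y)))
          (wcompl (wplus (wcompl x) y)) = x;
  ax_wa : forall x,
    let meet a b := wcompl (wplus (wcompl a) (wcompl b)) in
    let one := wplus wid (wcompl wid) in
    wsemi (wsemi (meet x wid) one) one = wsemi (meet x wid) one;
  ax_distr : forall x y z, wsemi (wplus x y) z = wplus (wsemi x z) (wsemi y z);
  ax_ident : forall x, wsemi x wid = x;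
  ax_convconv : forall x, wconv (wconv x) = x;
  ax_convplus : forall x y, wconv (wplus x y) = wplus (wconv x) (wconv y);
  ax_convsemi : forall x y, wconv (wsemi x y) = wsemi (wconv y) (wconv x);
  ax_tarski : forall x y,
    wplus (wsemi (wconv x) (wcompl (wsemi x y))) (wcompl y) = wcompl y
}.

Section WADefs.
Variable W : WA.
Local Notation A := (car W).

Definition wmeet (x y : A) : A := @wcompl W (@wplus W (@wcompl W x) (@wcompl W y)).
Definition wdiv : A := @wcompl W (wid W).
Definition wtop : A := @wplus W (wid W) wdiv.
Definition wzero : A := @wcompl W wtop.
Definition wle (x y : A) : Prop := @wplus W x y = y.

Definition wcomplete : Prop :=
  forall X : A -> Prop, exists s : A,
    (forall x, X x -> wle x s) /\
    (forall u, (forall x, X x -> wle x u) -> wle s u).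

Definition watom (a : A) : Prop :=
  a <> wzero /\ forall y, wle y a -> y = wzero \/ y = a.

Definition watomic : Prop :=
  forall x, x <> wzero -> exists a, watom a /\ wle a x.

Inductive idx := I0 | I1 | I2.

Definition triple := (A * A * A)%type.
Definition tcomp (s : triple) (k : idx) : A :=
  match s with (s0, s1, s2) => match k with I0 => s0 | I1 => s1 | I2 => s2 end end.

Definition inB (s : triple) : Prop :=
  watom (tcomp s I0) /\ watom (tcomp s I1) /\ watom (tcomp s I2) /\
  wle (tcomp s I1) (@wsemi W (tcomp s I2) (tcomp s I0)).

Definition Trel (k : idx) (s t : triple) : Prop :=
  inB s /\ inB t /\ tcomp s k = tcomp t k.

Definition Erel (k l : idx) (s : triple) : Prop :=
  inB s /\ (k = l \/ (k <> l /\ forall mu, mu <> k -> mu <> l -> wle (tcomp s mu) (wid W))).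

Definition trailseq := list (triple * idx).

Fixpoint chain (p : trailseq) : Prop :=
  match p with
  | [] => True
  | [(t, _)] => inB t
  | (t, k) :: ((t', _) :: _) as r => inB t /\ t <> t' /\ Trel k t t' /\ chain r
  end.

Definition is_trail (p : trailseq) : Prop := p <> [] /\ chain p.

Definition ends_at (p : trailseq) (t : triple) : Prop :=
  exists q k, p = q ++ [(t, k)].

Fixpoint set_last (p : trailseq) (l : idx) : trailseq :=
  match p with
  | [] => []
  | [(t, _)] => [(t, l)]
  | x :: r => x :: set_last r l
  end.

Definition gen_a (p q : trailseq) : Prop :=
  exists pre t l s k post,
    p = pre ++ (t, l) :: (s, l) :: (t, k) :: post /\ q = pre ++ (t, k) :: post.

Definition gen_b (p q : trailseq) : Prop :=
  exists pre t l s n, l <> n /\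
    p = pre ++ [(t, l); (s, n)] /\ q = pre ++ [(t, n)].

Definition gen_c (p q : trailseq) : Prop :=
  exists pre t l k, Erel l k t /\
    p = pre ++ [(t, l)] /\ q = pre ++ [(t, k)].

Definition gen (p q : trailseq) : Prop :=
  is_trail p /\ is_trail q /\ (gen_a p q \/ gen_b p q \/ gen_c p q).

(** the smallest equivalence relation generated (restricted to trails, it is
    the smallest equivalence relation on Tr(B) containing the generators) *)
Definition trail_equiv : relation trailseq := clos_refl_sym_trans _ gen.

Definition cls (p : trailseq) : trailseq -> Prop :=
  fun q => is_trail q /\ trail_equiv p q.

Definition Ucls : Type :=
  { X : trailseq -> Prop | exists p, is_trail p /\ X = cls p }.

Definition Vrel (u v w : Ucls) : Prop :=
  exists t p, inB t /\ is_trail p /\ ends_at p t /\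
    proj1_sig u = cls (set_last p I0) /\
    proj1_sig v = cls (set_last p I1) /\
    proj1_sig w = cls (set_last p I2).

Definition Srel (u v : Ucls) : Prop := exists w, Vrel u v w.

End WADefs.

Definition rel_on (U : Type) := U -> U -> Prop.
Definition rel_eq (U : Type) (R S : rel_on U) : Prop := forall u v, R u v <-> S u v.

Definition is_set_rel_subalgebra (U : Type) (Ap : rel_on U -> Prop) : Prop :=
  (forall R S, Ap R -> Ap S -> Ap (fun u v => R u v \/ S u v)) /\
  (forall R, Ap R -> Ap (fun u v => ~ R u v)) /\
  (forall R S, Ap R -> Ap S -> Ap (fun u v => exists w, R u w /\ S w v)) /\
  (forall R, Ap R -> Ap (fun u v => R v u)) /\
  Ap (fun u v => u = v).

Definition in_relativ (U : Type) (Ap : rel_on U -> Prop) (E : rel_on U) (X : rel_on U) : Prop :=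
  exists R, Ap R /\ rel_eq X (fun u v => R u v /\ E u v).

Definition is_iso_relativ (W : WA) (U : Type) (Ap : rel_on U -> Prop) (E : rel_on U)
    (f : car W -> rel_on U) : Prop :=
  (forall x, in_relativ Ap E (f x)) /\
  (forall X, in_relativ Ap E X -> exists x, rel_eq (f x) X) /\
  (forall x y, rel_eq (f x) (f y) -> x = y) /\
  (forall x y, rel_eq (f (wplus W x y)) (fun u v => (f x u v \/ f y u v) /\ E u v)) /\
  (forall x, rel_eq (f (wcompl W x)) (fun u v => ~ f x u v /\ E u v)) /\
  (forall x y, rel_eq (f (wsemi W x y))
                 (fun u v => (exists w, f x u w /\ f y w v) /\ E u v)) /\
  (forall x, rel_eq (f (wconv W x)) (fun u v => f x v u /\ E u v)) /\
  rel_eq (f (wid W)) (fun u v => u = v /\ E u v).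

(* Main.v *)
(* Trails without their last index, modulo backtracking, form a forest: the universal
   covers of the graph with vertex set B and edges T_k, one for each base triangle.
   Each node carries a triangle whose directed edges are labelled by atoms, and passing
   to a child replaces one vertex of the triangle.  A point of U is either a vertex of a
   root or is created at exactly one node, as the new vertex of its triangle; tracing
   vertices back to their creation gives a normal form for trail equivalence.  If points
   are adjacent, they already occur together where the younger one was created.  Hence
   labels of pairs are well defined, and three pairwise adjacent points lie in a common
   triangle, which gives the embedding x |-> union of the edges labelled by atoms below x.

   The set algebra consists of all relations that are invariant under the automorphisms
   exchanging the trees rooted at two neighbours.  These automorphisms act transitively
   on the edges with a given label, so an invariant relation meets S in a union of label
   classes, and completeness provides the element represented by that union. *)

From Stdlib Require Import List Relations Classical ClassicalEpsilon PeanoNat.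
From Stdlib Require Import PropExtensionality FunctionalExtensionality ProofIrrelevance Lia.
Require Import Defs.
Import ListNotations.
Set Implicit Arguments.
Unset Strict Implicit.

(** * The Boolean reduct *)

Section BooleanReduct.
Variable W : WA.
Local Notation A := (car W).
Local Notation "x + y" := (wplus W x y).
Local Notation "- x" := (wcompl W x).
Local Notation "x * y" := (wmeet W x y).
Local Notation "x <= y" := (wle W x y).
Local Notation top := (wtop W).
Local Notation zero := (wzero W).
Implicit Types x y z : A.

Lemma plusC x y : x + y = y + x.
Proof. apply ax_comm. Qed.

Lemma plusA x y z : x + (y + z) = (x + y) + z.
Proof. apply ax_assoc. Qed.

Lemma plusCA x y z : x + (y + z) = y + (x + z).
Proof. now rewrite !plusA, (plusC x y). Qed.

Lemma huntington x y : -(-x + -y) + -(-x + y) = x.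
Proof. apply ax_huntington. Qed.

(** Huntington's axiom expands [x] and [-x] relative to [--x], and [-x] and [--x] relative to [-x].
    Up to commutativity the same four summands arise. *)
Lemma excluded_middle_compl x : x + - x = - x + - - x.
Proof.
  transitivity ((-(-x + ---x) + -(-x + --x)) + (-(--x + ---x) + -(--x + --x))).
  { now rewrite !huntington. }
  transitivity ((-(--x + --x) + -(--x + -x)) + (-(---x + --x) + -(---x + -x))).
  2: now rewrite !huntington.
  rewrite (plusC (--x) (-x)), (plusC (---x) (--x)), (plusC (---x) (-x)).
  set (a := -(-x + ---x)). set (b := -(-x + --x)).
  set (c := -(--x + ---x)). set (d := -(--x + --x)).
  rewrite <- !plusA, (plusCA a b), (plusCA d b), (plusCA a c), (plusCA d c).
  now rewrite (plusC a d).
Qed.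

(** The expansion of [--x] relative to [-x] becomes that of [x] relative to [--x] once [--x + ---x]
    is traded for [-x + --x]. *)
Lemma complK x : - - x = x.
Proof.
  rewrite <- (huntington (--x) (-x)), (plusC (---x)), <- (excluded_middle_compl (-x)).
  rewrite (plusC (---x)), plusC. apply huntington.
Qed.

Lemma plus_compl_const x y : x + - x = y + - y.
Proof.
  transitivity ((-(-x + -y) + -(-x + y)) + (-(--x + -y) + -(--x + y))).
  { now rewrite !huntington. }
  transitivity ((-(-y + -x) + -(-y + x)) + (-(--y + -x) + -(--y + x))).
  2: now rewrite !huntington.
  rewrite !complK, (plusC (-y) (-x)), (plusC (-y) x), (plusC y (-x)), (plusC y x).
  rewrite <- !plusA. f_equal. apply plusCA.
Qed.

Lemma plus_compl x : x + - x = top.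
Proof. apply plus_compl_const. Qed.

Lemma compl_zero : - zero = top.
Proof. apply complK. Qed.

(** The complement of [top + top] is absorbed by [zero], hence by [top]. Since [top] is the sum of
    [top + top] and this complement, it collapses to [top + top]. *)
Lemma top_plus_top : top + top = top.
Proof.
  assert (H1 : top + zero = top) by apply plus_compl.
  assert (H2 : - (top + top) + zero = zero).
  { transitivity (-(-zero + -zero) + -(-zero + zero)).
    - now rewrite compl_zero, H1.
    - apply huntington. }
  assert (H3 : - (top + top) + top = top).
  { rewrite <- H1 at 3. now rewrite plusCA, H2. }
  rewrite <- (plus_compl (top + top)) at 3.
  now rewrite <- plusA, (plusC top (- (top + top))), H3.
Qed.

Lemma plus_zero x : x + zero = x.
Proof.
  assert (H0 : zero + zero = zero).
  { transitivity (-(-zero + -zero) + -(-zero + zero)).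
    - rewrite compl_zero, top_plus_top. f_equal. unfold wzero. now rewrite plus_compl.
    - apply huntington. }
  transitivity (-(-x + -x) + -(-x + x) + zero).
  { now rewrite huntington. }
  rewrite <- (huntington x x) at 5.
  rewrite (plusC (- x) x), plus_compl. fold zero. now rewrite <- plusA, H0.
Qed.

Lemma plus_idem x : x + x = x.
Proof.
  pose proof (huntington (- x) (- x)) as H.
  rewrite !complK, plus_compl in H. fold zero in H. rewrite plus_zero in H.
  rewrite <- (complK (x + x)), H. apply complK.
Qed.

Lemma meet_split x y : x * y + x * - y = x.
Proof. unfold wmeet. rewrite complK. apply huntington. Qed.

Lemma meetC x y : x * y = y * x.
Proof. unfold wmeet. f_equal. apply plusC. Qed.

Lemma compl_plus x y : - (x + y) = - x * - y.
Proof. unfold wmeet. now rewrite !complK. Qed.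

Lemma absorb x y : x + x * y = x.
Proof.
  rewrite <- (meet_split x y) at 1 3.
  now rewrite <- plusA, (plusC (x * - y)), plusA, plus_idem.
Qed.

Lemma le_refl x : x <= x.
Proof. apply plus_idem. Qed.

Lemma le_trans x y z : x <= y -> y <= z -> x <= z.
Proof. unfold wle. intros H K. rewrite <- K, plusA, H. reflexivity. Qed.

Lemma le_antisym x y : x <= y -> y <= x -> x = y.
Proof. unfold wle. intros H K. now rewrite <- H, plusC. Qed.

Lemma le_plus_l x y : x <= x + y.
Proof. unfold wle. now rewrite plusA, plus_idem. Qed.

Lemma le_plus_r x y : y <= x + y.
Proof. rewrite plusC. apply le_plus_l. Qed.

Lemma plus_lub x y z : x <= z -> y <= z -> x + y <= z.
Proof. unfold wle. intros H K. now rewrite <- plusA, K. Qed.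

Lemma meet_le_l x y : x * y <= x.
Proof. unfold wle. rewrite plusC. apply absorb. Qed.

Lemma meet_le_r x y : x * y <= y.
Proof. rewrite meetC. apply meet_le_l. Qed.

Lemma le_compl x y : x <= y -> - y <= - x.
Proof. unfold wle. intros H. rewrite <- H, compl_plus, plusC. apply absorb. Qed.

Lemma meet_glb x y z : z <= x -> z <= y -> z <= x * y.
Proof.
  intros H K. rewrite <- (complK z). apply le_compl, plus_lub; now apply le_compl.
Qed.

Lemma le_meet_eq x y : x <= y -> x * y = x.
Proof.
  intro H. apply le_antisym; [apply meet_le_l | apply meet_glb; auto using le_refl].
Qed.

Lemma zero_le x : zero <= x.
Proof. unfold wle. rewrite plusC. apply plus_zero. Qed.

Lemma le_top x : x <= top.
Proof. rewrite <- (plus_compl x). apply le_plus_l. Qed.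

Lemma le_zero x : x <= zero -> x = zero.
Proof. intro H. apply le_antisym; auto using zero_le. Qed.

Lemma meet_compl x : x * - x = zero.
Proof. unfold wmeet. now rewrite plus_compl. Qed.

Lemma le_both_compl x y : x <= y -> x <= - y -> x = zero.
Proof.
  intros H K. apply le_zero. rewrite <- (meet_compl y). now apply meet_glb.
Qed.

Lemma atom_neq0 a : watom W a -> a <> zero.
Proof. now intros []. Qed.

Lemma atom_le_eq a b : watom W a -> watom W b -> a <= b -> a = b.
Proof. intros [Ha _] [_ Hb] H. destruct (Hb _ H); tauto. Qed.

Lemma atom_le_or_compl a x : watom W a -> a <= x \/ a <= - x.
Proof.
  intros [_ Ha]. destruct (Ha (a * x) (meet_le_l _ _)) as [E|E].
  - right. rewrite <- (meet_split a x), E, plusC, plus_zero. apply meet_le_r.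
  - left. rewrite <- E. apply meet_le_r.
Qed.

Lemma atom_not_le_compl a x : watom W a -> a <= x -> ~ a <= - x.
Proof. intros Ha H K. exact (atom_neq0 Ha (le_both_compl H K)). Qed.

Lemma atom_le_plus a x y : watom W a -> a <= x + y -> a <= x \/ a <= y.
Proof.
  intros Ha H. destruct (atom_le_or_compl x Ha) as [|Hx]; auto.
  destruct (atom_le_or_compl y Ha) as [|Hy]; auto.
  exfalso. apply (atom_not_le_compl Ha H). rewrite compl_plus. now apply meet_glb.
Qed.

Lemma le_by_atoms x y :
  watomic W -> (forall a, watom W a -> a <= x -> a <= y) -> x <= y.
Proof.
  intros Hat H. destruct (classic (x * - y = zero)) as [E|E].
  - rewrite <- (meet_split x y), E, plus_zero. apply meet_le_r.
  - destruct (Hat _ E) as [a [Ha Hle]]. exfalso.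
    apply (@atom_not_le_compl a y Ha).
    + apply H; auto. eapply le_trans; eauto using meet_le_l.
    + eapply le_trans; eauto using meet_le_r.
Qed.

End BooleanReduct.

(** * Cycles of atoms and domains *)

Section RelativeReduct.
Variable W : WA.
Hypothesis Hat : watomic W.
Local Notation A := (car W).
Local Notation "x + y" := (wplus W x y).
Local Notation "- x" := (wcompl W x).
Local Notation "x * y" := (wmeet W x y).
Local Notation "x ;; y" := (wsemi W x y) (at level 35, right associativity).
Local Notation "x ˘" := (wconv W x) (at level 1, left associativity, format "x ˘").
Local Notation "x <= y" := (wle W x y).
Local Notation top := (wtop W).
Local Notation zero := (wzero W).
Local Notation one' := (wid W).
Local Notation atom := (watom W).
Implicit Types x y z : A.

Lemma convK x : x˘˘ = x.
Proof. apply ax_convconv. Qed.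

Lemma conv_semi x y : (x ;; y)˘ = y˘ ;; x˘.
Proof. apply ax_convsemi. Qed.

Lemma conv_le x y : x <= y -> x˘ <= y˘.
Proof. unfold wle. intro H. now rewrite <- ax_convplus, H. Qed.

Lemma conv_zero : zero˘ = zero.
Proof. apply le_zero. rewrite <- (convK zero) at 2. apply conv_le, zero_le. Qed.

Lemma conv_id : one'˘ = one'.
Proof.
  rewrite <- (ax_ident W one'˘). rewrite <- (convK one') at 2.
  rewrite <- conv_semi, ax_ident. apply convK.
Qed.

Lemma conv_le_id x : x <= one' -> x˘ <= one'.
Proof. intro H. rewrite <- conv_id. now apply conv_le. Qed.

Lemma conv_atom a : atom a -> atom a˘.
Proof.
  intros [H0 Ha]. split.
  - intro E. apply H0. now rewrite <- (convK a), E, conv_zero.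
  - intros y Hy. apply conv_le in Hy. rewrite convK in Hy.
    destruct (Ha _ Hy) as [E|E]; [left|right]; rewrite <- (convK y), E; auto using conv_zero.
Qed.

Lemma semi_le_l x y z : x <= y -> x ;; z <= y ;; z.
Proof. unfold wle. intro H. now rewrite <- ax_distr, H. Qed.

Lemma semi_le_r x y z : x <= y -> z ;; x <= z ;; y.
Proof.
  intro H. rewrite <- (convK (z ;; x)), <- (convK (z ;; y)).
  apply conv_le. rewrite !conv_semi. now apply semi_le_l, conv_le.
Qed.

Lemma semi_le x y z t : x <= y -> z <= t -> x ;; z <= y ;; t.
Proof. intros. eapply le_trans; [apply semi_le_l | apply semi_le_r]; eauto. Qed.

Lemma semi_id_l x : one' ;; x = x.
Proof. now rewrite <- (convK (one' ;; x)), conv_semi, conv_id, ax_ident, convK. Qed.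

Lemma semi_le_id_l e x : e <= one' -> e ;; x <= x.
Proof. intro H. rewrite <- (semi_id_l x) at 2. now apply semi_le_l. Qed.

Lemma semi_le_id_r e x : e <= one' -> x ;; e <= x.
Proof. intro H. rewrite <- (ax_ident W x) at 2. now apply semi_le_r. Qed.

(** Otherwise the atom [b] lies below the complement of [x˘ ;; a], and the Tarski axiom for [x˘] and
    [a] puts [a] below its own complement. *)
Lemma peirce a b x : atom a -> atom b -> a <= x ;; b -> b <= x˘ ;; a.
Proof.
  intros Ha Hb H. destruct (atom_le_or_compl (x˘ ;; a) Hb) as [|K]; auto.
  exfalso. apply (atom_not_le_compl Ha (le_refl a)).
  eapply le_trans; [exact H|]. eapply le_trans; [apply semi_le_r, K|].
  pose proof (ax_tarski W (x˘) a) as T. now rewrite convK in T.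
Qed.

(** This replaces complete additivity of composition. If no atom of [y] works, the Peirce law puts
    all of them, hence [y], below the complement of [x˘ ;; c], and the Tarski axiom gives a
    contradiction. *)
Lemma semi_atom_r c x y :
  atom c -> c <= x ;; y -> exists b, atom b /\ b <= y /\ c <= x ;; b.
Proof.
  intros Hc H. apply NNPP. intro N.
  apply (atom_not_le_compl Hc (le_refl c)).
  eapply le_trans; [exact H|]. eapply le_trans; [apply semi_le_r|].
  2: { pose proof (ax_tarski W (x˘) c) as T. rewrite convK in T. exact T. }
  apply (le_by_atoms Hat). intros b Hb Hby.
  destruct (atom_le_or_compl (x˘ ;; c) Hb) as [K|]; auto.
  exfalso. apply N. exists b. split; [exact Hb | split; [exact Hby |]].
  apply peirce in K; auto. now rewrite convK in K.
Qed.

Lemma semi_atom_l c x y :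
  atom c -> c <= x ;; y -> exists a, atom a /\ a <= x /\ c <= a ;; y.
Proof.
  intros Hc H. apply conv_le in H. rewrite conv_semi in H.
  destruct (semi_atom_r (conv_atom Hc) H) as (a & Ha & Hx & K).
  exists a˘. split; [now apply conv_atom|]. split.
  - apply conv_le in Hx. now rewrite convK in Hx.
  - apply conv_le in K. now rewrite conv_semi, !convK in K.
Qed.

Lemma semi_atoms c x y :
  atom c -> c <= x ;; y ->
  exists a b, atom a /\ atom b /\ a <= x /\ b <= y /\ c <= a ;; b.
Proof.
  intros Hc H. destruct (semi_atom_l Hc H) as (a & Ha & Hx & K).
  destruct (semi_atom_r Hc K) as (b & Hb & Hy & L). eauto 10.
Qed.

Definition cycle a b c := atom a /\ atom b /\ atom c /\ c <= a ;; b.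

Lemma cycle_peirce a b c : cycle a b c -> cycle a˘ c b.
Proof. intros (Ha & Hb & Hc & H). red. auto using conv_atom, peirce. Qed.

Lemma cycle_conv a b c : cycle a b c -> cycle b˘ a˘ c˘.
Proof.
  intros (Ha & Hb & Hc & H). split; [|split; [|split]]; auto using conv_atom.
  rewrite <- conv_semi. now apply conv_le.
Qed.

Lemma cycle_rot a b c : cycle a b c -> cycle c b˘ a.
Proof.
  intro H. apply cycle_conv, cycle_peirce, cycle_conv in H. now rewrite !convK in H.
Qed.

Lemma cycle_id_l e b c : cycle e b c -> e <= one' -> c = b.
Proof.
  intros (He & Hb & Hc & H) Hid. apply atom_le_eq; auto.
  eapply le_trans; [exact H|]. now apply semi_le_id_l.
Qed.

Lemma cycle_id_r a e c : cycle a e c -> e <= one' -> c = a.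
Proof.
  intros (He & Hb & Hc & H) Hid. apply atom_le_eq; auto.
  eapply le_trans; [exact H|]. now apply semi_le_id_r.
Qed.

(** The part of the identity at the source of [a]; it will label the loop at that vertex. *)
Definition is_dom e a := e <= one' /\ cycle e a a.

Lemma is_dom_exists a : atom a -> exists e, is_dom e a.
Proof.
  intro Ha. destruct (@semi_atom_l a one' a Ha) as (e & He & Hid & H).
  - rewrite semi_id_l. apply le_refl.
  - exists e. unfold is_dom, cycle. auto.
Qed.

(* The only use of weak associativity: [c <= a ;; b <= (e ;; 1) ;; 1 = e ;; 1]. *)
Lemma is_dom_semi e a b c : is_dom e a -> cycle a b c -> is_dom e c.
Proof.
  intros [Hid (He & Ha & _ & H)] (_ & Hb & Hc & K).
  assert (L : c <= e ;; top).
  { pose proof (ax_wa W e) as wa.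
    change (((e * one') ;; top) ;; top = (e * one') ;; top) in wa.
    rewrite (le_meet_eq Hid) in wa. rewrite <- wa.
    eapply le_trans; [exact K|]. apply semi_le; [|apply le_top].
    eapply le_trans; [exact H|]. apply semi_le_r, le_top. }
  destruct (semi_atom_r Hc L) as (x & Hx & _ & M).
  assert (C : cycle e x c) by (red; auto).
  rewrite <- (cycle_id_l C Hid) in C. now split.
Qed.

(** Through the cycle [a], [a˘], [e], the domain [f] of [a] is also a domain of [e]. As [e] is below
    the identity, the cycle [f], [e], [e] forces [e = f]. *)
Lemma is_dom_unique e f a : is_dom e a -> is_dom f a -> e = f.
Proof.
  intros [He Ce] Hf.
  assert (C : cycle a a˘ e) by now apply cycle_rot.
  destruct (is_dom_semi Hf C) as [Hid K].
  exact (cycle_id_r K He).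
Qed.

Lemma is_dom_id e : atom e -> e <= one' -> is_dom e e.
Proof.
  intros He Hid. destruct (is_dom_exists He) as (f & Hf & C).
  pose proof (cycle_id_r C Hid) as ->. now split.
Qed.

Lemma conv_id_atom e : atom e -> e <= one' -> e˘ = e.
Proof.
  intros He Hid. destruct (is_dom_id He Hid) as [_ C].
  apply cycle_peirce in C. symmetry. exact (cycle_id_r C Hid).
Qed.

Definition dom a := epsilon (inhabits zero) (fun e => is_dom e a).

Lemma domP a : atom a -> is_dom (dom a) a.
Proof. intro Ha.
  apply (epsilon_spec (inhabits zero) (fun e => is_dom e a)), is_dom_exists, Ha. Qed.

Lemma dom_eq e a : is_dom e a -> dom a = e.
Proof.
  intro H. apply (@is_dom_unique _ _ a); auto. apply domP, H.
Qed.

Lemma dom_semi a b c : cycle a b c -> dom c = dom a.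
Proof. intro C. apply dom_eq. apply (is_dom_semi (domP (proj1 C)) C). Qed.

Lemma dom_atom a : atom a -> atom (dom a).
Proof. intro Ha. apply (domP Ha). Qed.

Lemma dom_le_id a : atom a -> dom a <= one'.
Proof. intro Ha. apply (domP Ha). Qed.

Lemma dom_dom a : atom a -> dom (dom a) = dom a.
Proof. intro Ha. apply dom_eq, is_dom_id; auto using dom_atom, dom_le_id. Qed.

Lemma conv_dom a : atom a -> (dom a)˘ = dom a.
Proof. intro Ha. apply conv_id_atom; auto using dom_atom, dom_le_id. Qed.

Lemma cycle_dom_l a : atom a -> cycle (dom a) a a.
Proof. intro Ha. apply (domP Ha). Qed.

Lemma cycle_conv_r a : atom a -> cycle a a˘ (dom a).
Proof. intro Ha. now apply cycle_rot, cycle_dom_l. Qed.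

Lemma cycle_dom_r a : atom a -> cycle a (dom a˘) a.
Proof.
  intro Ha. pose proof (cycle_conv (cycle_dom_l (conv_atom Ha))) as C.
  now rewrite !convK, conv_dom in C by now apply conv_atom.
Qed.

Lemma cycle_dom_mid a b c : cycle a b c -> dom a˘ = dom b.
Proof. intro C. symmetry. exact (dom_semi (cycle_peirce C)). Qed.

End RelativeReduct.

(** * Triangles and reduced trails *)

Section Triangles.
Variable W : WA.
Hypothesis Hat : watomic W.
Local Notation A := (car W).
Local Notation "x ;; y" := (wsemi W x y) (at level 35, right associativity).
Local Notation "x ˘" := (wconv W x) (at level 1, left associativity, format "x ˘").
Local Notation "x <= y" := (wle W x y).
Local Notation one' := (wid W).
Local Notation atom := (watom W).
Local Notation T := (triple W).
Implicit Types (s t : T) (i j k l : idx).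

(* [t] is read as a triangle with vertices 0, 1, 2, and [lab t i j] is the label of
   its directed edge from [i] to [j]; the component [t_k] labels the edge opposite [k]. *)
Definition lab t i j : A :=
  match i, j with
  | I0, I1 => tcomp t I2
  | I1, I2 => tcomp t I0
  | I0, I2 => tcomp t I1
  | I1, I0 => (tcomp t I2)˘
  | I2, I1 => (tcomp t I0)˘
  | I2, I0 => (tcomp t I1)˘
  | I0, I0 => dom (tcomp t I2)
  | I1, I1 => dom (tcomp t I0)
  | I2, I2 => dom (tcomp t I1)˘
  end.

Lemma inB_cycle t : inB t -> cycle (tcomp t I2) (tcomp t I0) (tcomp t I1).
Proof. unfold inB, cycle. tauto. Qed.

Lemma lab_atom t i j : inB t -> atom (lab t i j).
Proof.
  intros (H0 & H1 & H2 & _).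
  destruct i, j; simpl; auto using conv_atom, dom_atom.
Qed.

Lemma lab_conv t i j : inB t -> lab t j i = (lab t i j)˘.
Proof.
  intros (H0 & H1 & H2 & _).
  destruct i, j; simpl; rewrite ?convK; auto; symmetry; apply conv_dom;
    auto using conv_atom.
Qed.

Lemma dom_lab t i j : inB t -> dom (lab t i j) = lab t i i.
Proof.
  intros H. pose proof (inB_cycle H) as C. destruct H as (H0 & H1 & H2 & _).
  destruct i, j; simpl; auto using dom_dom, conv_atom.
  - exact (dom_semi Hat C).
  - exact (cycle_dom_mid Hat C).
  - symmetry. exact (dom_semi Hat (cycle_conv C)).
Qed.

(** If two of the vertices are equal, the domain laws apply; the six remaining cases are the
    Peircean transforms of the cycle that defines membership in B. *)
Lemma lab_cycle t i j k : inB t -> cycle (lab t i j) (lab t j k) (lab t i k).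
Proof.
  intros H. pose proof (inB_cycle H) as C.
  assert (Hl : forall i k, cycle (lab t i i) (lab t i k) (lab t i k)).
  { intros a b. rewrite <- (dom_lab a b H). apply cycle_dom_l; auto using lab_atom. }
  assert (Hr : forall i j, cycle (lab t i j) (lab t j j) (lab t i j)).
  { intros a b. rewrite <- (dom_lab b a H), (lab_conv a b H).
    apply cycle_dom_r; auto using lab_atom. }
  assert (Hc : forall i j, cycle (lab t i j) (lab t j i) (lab t i i)).
  { intros a b. rewrite <- (dom_lab a b H), (lab_conv a b H).
    apply cycle_conv_r; auto using lab_atom. }
  destruct i, j, k; auto; simpl.
  - exact (cycle_rot C).
  - exact (cycle_peirce C).
  - exact (cycle_rot (cycle_peirce C)).
  - exact (cycle_peirce (cycle_rot C)).
  - exact (cycle_conv C).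
Qed.

Definition same t i j := lab t i j <= one'.

Lemma same_refl t i : inB t -> same t i i.
Proof.
  intros H. unfold same. rewrite <- (dom_lab i i H). apply dom_le_id; auto using lab_atom.
Qed.

Lemma same_lab t i j k : inB t -> same t i j -> lab t i k = lab t j k.
Proof. intros H E. exact (cycle_id_l (lab_cycle i j k H) E). Qed.

Lemma same_lab_r t i j k : inB t -> same t i j -> lab t k i = lab t k j.
Proof. intros H E. now rewrite (lab_conv i k), (lab_conv j k), (same_lab k H E). Qed.

Lemma same_sym t i j : inB t -> same t i j -> same t j i.
Proof. intros H E. unfold same. rewrite (lab_conv i j H). now apply conv_le_id. Qed.

Lemma same_trans t i j k : inB t -> same t i j -> same t j k -> same t i k.
Proof. intros H E F. unfold same. now rewrite (same_lab k H E). Qed.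

Lemma Erel_same t i j : inB t -> (Erel i j t <-> same t i j).
Proof.
  intros H. split.
  - intros (_ & [-> | [N E]]); [now apply same_refl|].
    destruct i, j; try congruence; unfold same; simpl;
      try apply conv_le_id; apply E; discriminate.
  - intro E. split; auto.
    destruct i, j; auto; right; split; try discriminate;
      intros [] ? ?; try congruence; unfold same in E; simpl in E; auto;
      apply conv_le_id in E; now rewrite convK in E.
Qed.

Lemma Trel_lab k s t i j : Trel k s t -> i <> k -> j <> k -> lab s i j = lab t i j.
Proof.
  intros (Hs & Ht & E) Hi Hj.
  assert (O : forall i j, i <> k -> j <> k -> i <> j -> lab s i j = lab t i j).
  { intros a b Ha Hb N. destruct k, a, b; try congruence; simpl; now rewrite E. }
  destruct (classic (i = j)) as [<- | N]; auto.
  (* The loop at [i] is the domain of a proper edge from [i] that avoids [k], and such an edge is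
     shared by [s] and [t]. *)
  assert (exists l, l <> k /\ i <> l) as (l & Hl & Nl).
  { destruct k, i; try congruence;
      ((exists I0; split; congruence) || (exists I1; split; congruence)
       || (exists I2; split; congruence)). }
  rewrite <- (dom_lab i l Hs), <- (dom_lab i l Ht). now rewrite O.
Qed.

Lemma Trel_same k s t i j : Trel k s t -> i <> k -> j <> k -> same s i j -> same t i j.
Proof. intros H Hi Hj. unfold same. now rewrite (Trel_lab H Hi Hj). Qed.

Lemma Trel_sym k s t : Trel k s t -> Trel k t s.
Proof. unfold Trel. intuition. Qed.

(** The map [f] may identify vertices, which yields degenerate triangles. *)
Definition pull t (f : idx -> idx) : T :=
  (lab t (f I1) (f I2), lab t (f I0) (f I2), lab t (f I0) (f I1)).

Lemma pull_inB t f : inB t -> inB (pull t f).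
Proof.
  intro H. pose proof (lab_cycle (f I0) (f I1) (f I2) H).
  unfold inB, cycle in *. simpl. tauto.
Qed.

(** * The forest and the creation of vertices *)

Inductive node := Root (t : T) | Step (y : node) (k : idx) (s : T).
Implicit Types (x y z : node).

Definition tri z := match z with Root t => t | Step _ _ s => s end.

Definition backtracks z k t :=
  match z with Root _ => False | Step y k' _ => k' = k /\ tri y = t end.

Fixpoint valid z :=
  match z with
  | Root t => inB t
  | Step y k s => valid y /\ Trel k (tri y) s /\ ~ backtracks y k s
  end.

Fixpoint depth z := match z with Root _ => 0 | Step y _ _ => S (depth y) end.

(** The edge opposite [k] is shared with the parent, so a vertex is inherited exactly when it
    coincides with an end of that edge; [None] marks a new vertex. *)
Definition carry s k i : option idx :=
  match excluded_middle_informative (exists j, j <> k /\ same s i j) with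
  | left H => Some (proj1_sig (constructive_indefinite_description _ H))
  | right _ => None
  end.

(** At a root, coinciding vertices need one common name. The choice depends only on the predicate
    [same t i], hence only on the class of [i]. *)
Definition rep t i := epsilon (inhabits I0) (same t i).

(* The vertices of the triangle at [z] are either new at [z] or inherited from the
   parent; [nf z i] traces vertex [i] back to the node where it was created. *)
Fixpoint nf z i : node * idx :=
  match z with
  | Root t => (z, rep t i)
  | Step y k s => match carry s k i with Some j => nf y j | None => (z, k) end
  end.

Lemma valid_inB z : valid z -> inB (tri z).
Proof. destruct z; simpl; auto. now intros (_ & (_ & H & _) & _). Qed.

Lemma carryP s k i :
  match carry s k i with
  | Some j => j <> k /\ same s i j
  | None => forall j, j <> k -> ~ same s i j
  end.
Proof.
  unfold carry. destruct excluded_middle_informative as [H|H].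
  - now destruct constructive_indefinite_description.
  - intros j N E. eauto.
Qed.

Lemma carry_None s k i : inB s -> carry s k i = None -> i = k.
Proof.
  intros H E. pose proof (carryP s k i) as C. rewrite E in C.
  apply NNPP. intro N. exact (C i N (same_refl i H)).
Qed.

Lemma rep_same t i : inB t -> same t i (rep t i).
Proof.
  intro H. apply (epsilon_spec (inhabits I0) (same t i)). exists i. now apply same_refl.
Qed.

Lemma same_rep t i j : inB t -> same t i j -> rep t i = rep t j.
Proof.
  intros H E. unfold rep. f_equal. extensionality k. apply propositional_extensionality.
  split; intro F; eauto using same_trans, same_sym.
Qed.

Lemma nf_depth z i : (depth (fst (nf z i)) <= depth z)%nat.
Proof.
  revert i. induction z as [t | y IH k s]; intro i; simpl; auto.
  destruct (carry s k i) as [j|]; [specialize (IH j); lia | auto].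
Qed.

(** Inherited vertices that coincide do so already on the edge shared with the parent, and a new
    vertex never coincides with an inherited one. *)
Lemma nf_same z i j : valid z -> same (tri z) i j -> nf z i = nf z j.
Proof.
  revert i j. induction z as [t | y IH k s]; simpl; intros i j V E.
  - now rewrite (same_rep V E).
  - destruct V as (V & HT & _). pose proof (proj1 (proj2 HT)) as Hs.
    pose proof (carryP s k i) as Ci. pose proof (carryP s k j) as Cj.
    destruct (carry s k i) as [i'|], (carry s k j) as [j'|]; auto.
    + destruct Ci as [Ni Ei], Cj as [Nj Ej]. apply IH; auto.
      apply (Trel_same (Trel_sym HT)); auto.
      eauto using same_trans, same_sym.
    + destruct Ci as [Ni Ei]. exfalso. eapply Cj; eauto using same_trans, same_sym.
    + destruct Cj as [Nj Ej]. exfalso. eapply Ci; eauto using same_trans, same_sym.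
Qed.

(** A new vertex is created strictly deeper than any inherited one, so equal normal forms are both
    new or both inherited. *)
Lemma nf_inj z i j : valid z -> nf z i = nf z j -> same (tri z) i j.
Proof.
  revert i j. induction z as [t | y IH k s]; simpl; intros i j V E.
  - injection E as E. apply same_trans with (rep t i); auto using rep_same.
    rewrite E. auto using same_sym, rep_same.
  - destruct V as (V & HT & _). pose proof (proj1 (proj2 HT)) as Hs.
    pose proof (carryP s k i) as Ci. pose proof (carryP s k j) as Cj.
    pose proof (@carry_None s k i Hs) as Di. pose proof (@carry_None s k j Hs) as Dj.
    destruct (carry s k i) as [i'|], (carry s k j) as [j'|].
    + destruct Ci as [Ni Ei], Cj as [Nj Ej].
      apply (same_trans Hs Ei). apply same_trans with j'; auto using same_sym.
      now apply (Trel_same HT), IH.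
    + pose proof (nf_depth y i') as L. rewrite E in L. simpl in L. lia.
    + pose proof (nf_depth y j') as L. rewrite <- E in L. simpl in L. lia.
    + rewrite Di, Dj by auto. now apply same_refl.
Qed.

Lemma nf_valid z i : valid z -> valid (fst (nf z i)).
Proof.
  revert i. induction z as [t | y IH k s]; intros i V; auto.
  simpl. destruct (carry s k i); [apply IH, V | exact V].
Qed.

Lemma nf_idem z i : valid z -> nf (fst (nf z i)) (snd (nf z i)) = nf z i.
Proof.
  revert i. induction z as [t | y IH k s]; simpl; intros i V.
  - f_equal. now apply same_rep; auto; apply same_sym; auto; apply rep_same.
  - pose proof (@carry_None s k i (proj1 (proj2 (proj1 (proj2 V))))) as D.
    destruct (carry s k i) as [j|] eqn:E; [apply IH, V |].
    specialize (D eq_refl). subst i. simpl. now rewrite E.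
Qed.

(* Two vertices of a common triangle already occur together, with the same label, in
   the triangle where the younger of them was created. *)
Lemma lab_nf z i j :
  valid z -> (depth (fst (nf z j)) <= depth (fst (nf z i)))%nat ->
  exists j0, nf (fst (nf z i)) j0 = nf z j /\
    lab (tri z) i j = lab (tri (fst (nf z i))) (snd (nf z i)) j0.
Proof.
  revert i j. induction z as [t | y IH k s]; intros i j V.
  - intros _. exists j. split; auto. apply (same_lab j V), rep_same, V.
  - simpl. destruct V as (V & HT & NB). pose proof (proj1 (proj2 HT)) as Hs.
    pose proof (carryP s k i) as Ci. pose proof (carryP s k j) as Cj.
    pose proof (@carry_None s k i Hs) as Di.
    destruct (carry s k i) as [i'|].
    + destruct (carry s k j) as [j'|].
      * intro L. destruct Ci as [Ni Ei], Cj as [Nj Ej].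
        destruct (IH i' j' V L) as (j0 & E & F). exists j0. split; auto.
        rewrite <- F, (Trel_lab HT Ni Nj), (same_lab j Hs Ei).
        now apply same_lab_r.
      * simpl. pose proof (nf_depth y i'). lia.
    + intros _. exists j. rewrite (Di eq_refl). split; auto.
Qed.

(** * Adjacency of created vertices *)

Definition adj (P Q : node * idx) a :=
  exists z i j, valid z /\ nf z i = P /\ nf z j = Q /\ lab (tri z) i j = a.

Lemma adj_conv P Q a : adj P Q a -> adj Q P a˘.
Proof.
  intros (z & i & j & V & H1 & H2 & <-). exists z, j, i.
  repeat split; auto. apply lab_conv. now apply valid_inB.
Qed.

Lemma adj_young P Q a :
  adj P Q a -> (depth (fst Q) <= depth (fst P))%nat ->
  valid (fst P) /\ nf (fst P) (snd P) = P /\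
  exists j, nf (fst P) j = Q /\ lab (tri (fst P)) (snd P) j = a.
Proof.
  intros (z & i & j & V & <- & <- & <-) L.
  destruct (lab_nf V L) as (j0 & E & F).
  split; [now apply nf_valid|]. split; [now apply nf_idem|]. exists j0. auto.
Qed.

(** Both labels can be read in the triangle where the younger vertex was created, and there [nf_inj]
    identifies the two positions of the older one. *)
Lemma adj_fun P Q a b : adj P Q a -> adj P Q b -> a = b.
Proof.
  assert (Y : forall P Q a b, (depth (fst Q) <= depth (fst P))%nat ->
              adj P Q a -> adj P Q b -> a = b).
  { clear -Hat. intros P Q a b L Ha Hb.
    destruct (adj_young Ha L) as (V & _ & j & E & <-).
    destruct (adj_young Hb L) as (_ & _ & j' & E' & <-).
    rewrite <- E' in E. apply same_lab_r; [now apply valid_inB | now apply nf_inj]. }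
  intros Ha Hb. destruct (Nat.le_ge_cases (depth (fst Q)) (depth (fst P))) as [L|L].
  - exact (Y P Q a b L Ha Hb).
  - rewrite <- (convK a), <- (convK b). f_equal. apply (Y Q P); auto using adj_conv.
Qed.

(** The triangle that created the youngest of the three vertices contains the other two, so the
    labels are those of one triangle. *)
Lemma adj_cycle P Q R a b c : adj P Q a -> adj Q R b -> adj P R c -> cycle a b c.
Proof.
  intros Ha Hb Hc.
  assert (exists z i j k, valid z /\ nf z i = P /\ nf z j = Q /\ nf z k = R)
    as (z & i & j & k & V & <- & <- & <-).
  { assert (Y : forall P Q R a c, adj P Q a -> adj P R c ->
       (depth (fst Q) <= depth (fst P))%nat -> (depth (fst R) <= depth (fst P))%nat ->
       exists z i j k, valid z /\ nf z i = P /\ nf z j = Q /\ nf z k = R).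
    { clear -Hat. intros P Q R a c Ha Hc L M.
      destruct (adj_young Ha L) as (V & E & j & F & _).
      destruct (adj_young Hc M) as (_ & _ & k & G & _). eauto 10. }
    assert (((depth (fst Q) <= depth (fst P)) /\ (depth (fst R) <= depth (fst P)) \/
             (depth (fst P) <= depth (fst Q)) /\ (depth (fst R) <= depth (fst Q)) \/
             (depth (fst P) <= depth (fst R)) /\ (depth (fst Q) <= depth (fst R)))%nat)
      as [[L M] | [[L M] | [L M]]] by lia.
    - exact (Y P Q R _ _ Ha Hc L M).
    - destruct (Y Q P R _ _ (adj_conv Ha) Hb L M) as (z & i & j & k & H).
      exists z, j, i, k. tauto.
    - destruct (Y R P Q _ _ (adj_conv Hc) (adj_conv Hb) L M) as (z & i & j & k & H).
      exists z, j, k, i. tauto. }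
  pose proof (lab_cycle i j k (valid_inB V)) as C.
  rewrite (adj_fun Ha (b := lab (tri z) i j)) by (exists z, i, j; auto).
  rewrite (adj_fun Hb (b := lab (tri z) j k)) by (exists z, j, k; auto).
  rewrite (adj_fun Hc (b := lab (tri z) i k)) by (exists z, i, k; auto).
  exact C.
Qed.

End Triangles.

(** * Points, edges and invariant relations *)

Section Trails.
Variable W : WA.
Hypothesis Hat : watomic W.
Local Notation A := (car W).
Local Notation "x ;; y" := (wsemi W x y) (at level 35, right associativity).
Local Notation "x ˘" := (wconv W x) (at level 1, left associativity, format "x ˘").
Local Notation "x <= y" := (wle W x y).
Local Notation one' := (wid W).
Local Notation atom := (watom W).
Local Notation T := (triple W).
Local Notation U := (Ucls W).
Implicit Types (s t : T) (i j k l : idx) (p q pre post : trailseq W) (z : node W).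
Implicit Types (u v w : U).

(** * Walking along trails *)

Definition move z k t :=
  if excluded_middle_informative (backtracks z k t)
  then match z with Root _ => z | Step y _ _ => y end
  else Step z k t.

Lemma move_valid z k t :
  valid z -> Trel k (tri z) t -> valid (move z k t) /\ tri (move z k t) = t.
Proof.
  intros V H. unfold move. destruct excluded_middle_informative as [B|B]; simpl; auto.
  destruct z as [|y k' s]; simpl in *; tauto.
Qed.

(** If the first move backtracks, the second restores the removed step; validity of [z] ensures that
    it is not a backtrack itself. *)
Lemma move_move z k s :
  valid z -> Trel k (tri z) s -> move (move z k s) k (tri z) = z.
Proof.
  intros V H. unfold move at 2. destruct excluded_middle_informative as [B|B].
  - destruct z as [|y k' s']; simpl in *; [tauto|].
    destruct B as [-> <-]. unfold move.
    destruct excluded_middle_informative; tauto.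
  - unfold move. destruct excluded_middle_informative as [C|C]; auto.
    simpl in C. tauto.
Qed.

Lemma nf_Step z k s n : valid (Step z k s) -> n <> k -> nf (Step z k s) n = nf z n.
Proof.
  intros (V & H & _) N. pose proof (proj1 (proj2 H)) as Hs. simpl.
  pose proof (carryP s k n) as C. pose proof (@carry_None W Hat s k n Hs) as D.
  destruct (carry s k n) as [j|]; [|now destruct N; apply D].
  destruct C as [Nj E]. apply nf_same; auto.
  apply (Trel_same Hat (Trel_sym H)); auto. now apply same_sym.
Qed.

Lemma nf_move z k s n :
  valid z -> Trel k (tri z) s -> n <> k -> nf (move z k s) n = nf z n.
Proof.
  intros V H N. pose proof (move_valid V H) as M. unfold move in *.
  destruct excluded_middle_informative as [B|B].
  - destruct z as [|y k' s']; simpl in B; [tauto|]. destruct B as [-> _].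
    symmetry. now apply nf_Step.
  - apply nf_Step; auto. apply M.
Qed.

(** An index in a trail governs the step to the next triangle, so it is kept pending; the one left
    at the end selects a vertex. *)
Definition visit (st : option (node W * idx)) (e : T * idx) :=
  match st with
  | None => Some (Root (fst e), snd e)
  | Some (z, k) => Some (move z k (fst e), snd e)
  end.

Definition walk p := fold_left visit p None.

Definition code p :=
  match walk p with Some (z, k) => Some (nf z k) | None => None end.

Lemma chain_inB t k p : chain ((t, k) :: p) -> inB t.
Proof. destruct p as [|[s l] p]; simpl; tauto. Qed.

Lemma chain_suffix p q : chain (p ++ q) -> chain q.
Proof.
  induction p as [|[t k] p IH]; simpl; auto. intro H. apply IH.
  destruct (p ++ q) as [|[s l] r]; [exact I | apply H].
Qed.

Lemma chain_prefix p q : chain (p ++ q) -> chain p.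
Proof.
  induction p as [|[t k] [|[s l] p] IH]; intro H.
  - exact I.
  - simpl app in H. simpl. now apply chain_inB in H.
  - destruct H as (H1 & H2 & H3 & H4). exact (conj H1 (conj H2 (conj H3 (IH H4)))).
Qed.

Lemma chain_last pre t k l : chain (pre ++ [(t, k)]) -> chain (pre ++ [(t, l)]).
Proof.
  induction pre as [|[t1 k1] [|[t2 k2] pre] IH]; simpl; auto; intuition.
Qed.

Lemma chain_snoc pre t k s l :
  chain (pre ++ [(t, k)]) -> t <> s -> Trel k t s -> chain (pre ++ [(t, k); (s, l)]).
Proof.
  intros H N R. induction pre as [|[t1 k1] [|[t2 k2] pre] IH].
  - simpl in *. repeat split; auto; apply R.
  - simpl in *. intuition.
  - destruct H as (H1 & H2 & H3 & H4). split; [|split; [|split]]; auto.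
Qed.

Lemma app_trail pre t k : chain (pre ++ [(t, k)]) -> is_trail (pre ++ [(t, k)]).
Proof. intro H. split; auto. now destruct pre. Qed.

Lemma set_last_app pre t k l : set_last (pre ++ [(t, k)]) l = pre ++ [(t, l)].
Proof.
  induction pre as [|[t1 k1] [|[t2 k2] pre] IH]; auto.
  change (((t1, k1) :: (t2, k2) :: pre) ++ [(t, k)])
    with ((t1, k1) :: (((t2, k2) :: pre) ++ [(t, k)])).
  simpl in *. now rewrite IH.
Qed.

Lemma snoc_head pre t :
  exists s m, forall i, exists r, pre ++ [(t, i)] = (s, m i) :: r.
Proof.
  destruct pre as [|[s m] pre]; simpl.
  - exists t, (fun i => i). eauto.
  - exists s, (fun _ => m). eauto.
Qed.

(** The final index does not influence the node reached. The [I0] in the hypothesis is an arbitrary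
    stand-in, by [chain_last]. *)
Lemma walk_node pre t :
  chain (pre ++ [(t, I0)]) ->
  exists z, valid z /\ tri z = t /\ forall k, walk (pre ++ [(t, k)]) = Some (z, k).
Proof.
  revert t. induction pre as [|[s l] pre IH] using rev_ind; intros t H.
  - exists (Root t). simpl in *. auto.
  - rewrite <- app_assoc in H. simpl in H.
    assert (C : chain (pre ++ [(s, l)])).
    { apply chain_prefix with [(t, I0)]. now rewrite <- app_assoc. }
    destruct (IH s (chain_last I0 C)) as (z & V & E & Hz).
    destruct (chain_suffix H) as (_ & _ & R & _). rewrite <- E in R.
    destruct (move_valid V R) as [V' E'].
    exists (move z l t). split; [|split]; auto. intro k.
    unfold walk in *. rewrite fold_left_app, Hz. reflexivity.
Qed.

(** The generators (a), (b), (c) are respected because of [move_move], [nf_move] and [nf_same],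
    respectively. *)
Lemma gen_code p q : gen p q -> code p = code q.
Proof.
  intros ([_ Hp] & [_ Hq] & [G | [G | G]]).
  - destruct G as (pre & t & l & s & k & post & -> & ->).
    assert (C : chain (pre ++ [(t, I0)])).
    { apply chain_last with k. apply chain_prefix with post.
      now rewrite <- app_assoc. }
    destruct (walk_node C) as (z & V & E & Hz).
    assert (R : Trel l (tri z) s).
    { rewrite E. apply chain_suffix in Hp. apply Hp. }
    unfold code, walk.
    replace (fold_left visit (pre ++ (t, l) :: (s, l) :: (t, k) :: post) None)
      with (fold_left visit (pre ++ (t, k) :: post) None); auto.
    change ((t, l) :: (s, l) :: (t, k) :: post)
      with ([(t, l)] ++ [(s, l); (t, k)] ++ post).
    change ((t, k) :: post) with ([(t, k)] ++ post).
    rewrite !app_assoc, !(fold_left_app _ _ post). f_equal.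
    rewrite (fold_left_app _ (pre ++ [(t, l)])). unfold walk in Hz. rewrite !Hz.
    simpl. now rewrite <- E, move_move.
  - destruct G as (pre & t & l & s & n & N & -> & ->).
    destruct (walk_node (chain_last I0 Hq)) as (z & V & E & Hz).
    assert (R : Trel l (tri z) s).
    { rewrite E. apply chain_suffix in Hp. apply Hp. }
    unfold code. rewrite Hz. unfold walk in *.
    change [(t, l); (s, n)] with ([(t, l)] ++ [(s, n)]).
    rewrite app_assoc, fold_left_app, Hz. simpl. f_equal. now apply nf_move; auto.
  - destruct G as (pre & t & l & k & G & -> & ->).
    destruct (walk_node (chain_last I0 Hq)) as (z & V & E & Hz).
    unfold code. rewrite !Hz. f_equal. apply nf_same; auto.
    rewrite E. apply Erel_same; auto. apply G.
Qed.

Lemma trail_equiv_code p q : trail_equiv p q -> code p = code q.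
Proof. induction 1; auto using gen_code. congruence. Qed.

Lemma equiv_trans p q r : trail_equiv p q -> trail_equiv q r -> trail_equiv p r.
Proof. apply rst_trans. Qed.

Lemma equiv_sym p q : trail_equiv p q -> trail_equiv q p.
Proof. apply rst_sym. Qed.

Lemma equiv_refl p : trail_equiv p p.
Proof. apply rst_refl. Qed.

Lemma extend pre t k s :
  chain (pre ++ [(t, I0)]) -> Trel k t s ->
  exists pre', chain (pre' ++ [(s, I0)]) /\
    forall i, i <> k -> trail_equiv (pre ++ [(t, i)]) (pre' ++ [(s, i)]).
Proof.
  (* Consecutive triangles of a trail differ, so no step is made when [t = s]. *)
  intros C R. destruct (classic (t = s)) as [<- | N].
  - exists pre. auto using equiv_refl.
  - assert (D : forall i, chain (pre ++ [(t, k); (s, i)])).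
    { intro i. apply chain_snoc; auto. exact (chain_last k C). }
    exists (pre ++ [(t, k)]). split; [now rewrite <- app_assoc; apply D|].
    intros i Hi. rewrite <- app_assoc. apply equiv_sym, rst_step.
    split; [|split].
    + split; [now destruct pre | apply D].
    + apply app_trail. exact (chain_last i C).
    + right. left. exists pre, t, k, s, i. auto.
Qed.

Lemma equiv_same pre t i j :
  chain (pre ++ [(t, I0)]) -> same t i j ->
  trail_equiv (pre ++ [(t, i)]) (pre ++ [(t, j)]).
Proof.
  intros C E. assert (Ht : inB t) by exact (chain_inB (chain_suffix C)).
  apply rst_step. split; [|split]; try (apply app_trail, (chain_last _ C)).
  right. right. exists pre, t, i, j. split; auto. now apply Erel_same.
Qed.

Lemma trail_inB pre t k : chain (pre ++ [(t, k)]) -> inB t.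
Proof. intro C. exact (chain_inB (chain_suffix C)). Qed.

Definition idx_eq_dec i j : {i = j} + {i <> j}.
Proof. decide equality. Defined.

Definition subst_idx k l i := if idx_eq_dec i k then l else i.

(** The points at vertices [f I0], [f I1], [f I2] of [t] are, in this order, the vertices of the
    last triangle of another trail. *)
Definition reachable pre t (f : idx -> idx) :=
  exists pre' s, chain (pre' ++ [(s, I0)]) /\
    forall i, trail_equiv (pre ++ [(t, f i)]) (pre' ++ [(s, i)]).

(* Move to the degenerate triangle in which vertex [k] is a copy of vertex [l]. *)
Lemma reachable_subst pre t f k l :
  reachable pre t f -> reachable pre t (fun i => f (subst_idx k l i)).
Proof.
  intros (pre1 & r & C & F). pose proof (trail_inB C) as Hr.
  destruct (idx_eq_dec k l) as [<- | N].
  { exists pre1, r. split; auto. intro i. unfold subst_idx.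
    destruct (idx_eq_dec i k) as [-> |]; apply F. }
  set (s := pull r (subst_idx k l)).
  assert (Hs : inB s) by now apply pull_inB.
  assert (R : Trel k r s).
  { split; [|split]; auto. destruct k; reflexivity. }
  assert (E : same s k l).
  { assert (K : forall i, lab r i i <= one') by (intro; now apply same_refl).
    pose proof (K I0). pose proof (K I1). pose proof (K I2).
    destruct k, l; try congruence; unfold same; simpl;
      try apply conv_le_id; assumption. }
  destruct (extend C R) as (pre' & C' & H).
  exists pre', s. split; auto. intro i. apply (equiv_trans (F _)). unfold subst_idx.
  destruct (idx_eq_dec i k) as [-> | Ni]; auto.
  apply equiv_trans with (pre' ++ [(s, l)]); auto.
  apply equiv_sym, equiv_same; auto.
Qed.

(** Only copying one vertex onto another is available; exchanging vertices 0 and 1 uses vertex 2 as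
    temporary storage. *)
Lemma reachable_pair pre t i j :
  chain (pre ++ [(t, I0)]) -> exists f, reachable pre t f /\ f I0 = i /\ f I1 = j.
Proof.
  intro C. assert (D : reachable pre t (fun i => i)).
  { exists pre, t. auto using equiv_refl. }
  pose (c k l f := @reachable_subst pre t f k l).
  destruct i, j.
  - exact (ex_intro _ _ (conj (c I1 I0 _ D) (conj eq_refl eq_refl))).
  - exact (ex_intro _ _ (conj (D) (conj eq_refl eq_refl))).
  - exact (ex_intro _ _ (conj (c I1 I2 _ D) (conj eq_refl eq_refl))).
  - exact (ex_intro _ _ (conj (c I1 I2 _ (c I0 I1 _ (c I2 I0 _ D))) (conj eq_refl eq_refl))).
  - exact (ex_intro _ _ (conj (c I0 I1 _ D) (conj eq_refl eq_refl))).
  - exact (ex_intro _ _ (conj (c I1 I2 _ (c I0 I1 _ D)) (conj eq_refl eq_refl))).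
  - exact (ex_intro _ _ (conj (c I0 I2 _ (c I1 I0 _ D)) (conj eq_refl eq_refl))).
  - exact (ex_intro _ _ (conj (c I0 I2 _ D) (conj eq_refl eq_refl))).
  - exact (ex_intro _ _ (conj (c I1 I2 _ (c I0 I2 _ D)) (conj eq_refl eq_refl))).
Qed.

(** * Points of U and labelled edges *)

Definition isc u p := proj1_sig u = cls p.

Lemma isc_exists p : is_trail p -> exists u, isc u p.
Proof.
  intro H. exists (exist _ (cls p) (ex_intro _ p (conj H eq_refl))). reflexivity.
Qed.

Lemma isc_surj u : exists p, is_trail p /\ isc u p.
Proof. destruct u as [X (p & H & ->)]. exists p. split; auto. reflexivity. Qed.

Lemma isc_inj u v p : isc u p -> isc v p -> u = v.
Proof.
  unfold isc. destruct u as [X HX], v as [Y HY]. simpl. intros -> ->.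
  f_equal. apply proof_irrelevance.
Qed.

Lemma isc_equiv u p q : trail_equiv p q -> isc u p -> isc u q.
Proof.
  unfold isc. intros E ->. unfold cls. extensionality r. apply propositional_extensionality.
  split; intros [H K]; split; auto; eauto using equiv_trans, equiv_sym.
Qed.

Lemma isc_unique u p q : is_trail q -> isc u p -> isc u q -> trail_equiv p q.
Proof.
  unfold isc. intros H -> E. assert (K : cls q q) by (split; auto using equiv_refl).
  rewrite <- E in K. apply K.
Qed.

Definition point u (P : node W * idx) :=
  exists p, is_trail p /\ isc u p /\ code p = Some P.

Lemma point_fun u P Q : point u P -> point u Q -> P = Q.
Proof.
  intros (p & Hp & Up & Cp) (q & Hq & Uq & Cq).
  pose proof (trail_equiv_code (isc_unique Hq Up Uq)). congruence.
Qed.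

Definition edge a u v :=
  exists pre t i j, chain (pre ++ [(t, I0)]) /\ lab t i j = a /\
    isc u (pre ++ [(t, i)]) /\ isc v (pre ++ [(t, j)]).

Lemma edge_point a u v :
  edge a u v -> exists P Q, point u P /\ point v Q /\ adj P Q a.
Proof.
  intros (pre & t & i & j & C & <- & Hu & Hv).
  destruct (walk_node C) as (z & V & E & Hz).
  exists (nf z i), (nf z j). split; [|split].
  - exists (pre ++ [(t, i)]). split; [exact (app_trail (chain_last i C))|].
    split; auto. unfold code. now rewrite Hz.
  - exists (pre ++ [(t, j)]). split; [exact (app_trail (chain_last j C))|].
    split; auto. unfold code. now rewrite Hz.
  - exists z, i, j. now rewrite E.
Qed.

Lemma edge_fun a b u v : edge a u v -> edge b u v -> a = b.
Proof.
  intros Ha Hb. destruct (edge_point Ha) as (P & Q & HP & HQ & Ka).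
  destruct (edge_point Hb) as (P' & Q' & HP' & HQ' & Kb).
  rewrite <- (point_fun HP HP'), <- (point_fun HQ HQ') in Kb.
  exact (adj_fun Hat Ka Kb).
Qed.

Lemma edge_cycle a b c u v w : edge a u v -> edge b v w -> edge c u w -> cycle a b c.
Proof.
  intros Ha Hb Hc. destruct (edge_point Ha) as (P & Q & HP & HQ & Ka).
  destruct (edge_point Hb) as (Q' & R & HQ' & HR & Kb).
  destruct (edge_point Hc) as (P' & R' & HP' & HR' & Kc).
  rewrite <- (point_fun HP HP'), <- (point_fun HR HR') in Kc.
  rewrite <- (point_fun HQ HQ') in Kb.
  exact (adj_cycle Hat Ka Kb Kc).
Qed.

Lemma edge_atom a u v : edge a u v -> atom a.
Proof.
  intros (pre & t & i & j & C & <- & _). apply lab_atom; auto. exact (trail_inB C).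
Qed.

Lemma edge_conv a u v : edge a u v -> edge a˘ v u.
Proof.
  intros (pre & t & i & j & C & <- & Hu & Hv). exists pre, t, j, i.
  repeat split; auto. apply lab_conv; auto. exact (trail_inB C).
Qed.

Lemma edge_id a u v : edge a u v -> (a <= one' <-> u = v).
Proof.
  intros (pre & t & i & j & C & <- & Hu & Hv). split.
  - intro E. apply (isc_inj (p := pre ++ [(t, j)])); auto.
    exact (isc_equiv (equiv_same C E) Hu).
  - intros <-. destruct (walk_node C) as (z & V & E & Hz).
    assert (K : nf z i = nf z j).
    { pose proof (trail_equiv_code (isc_unique (app_trail (chain_last j C)) Hu Hv)) as K.
      unfold code in K. rewrite !Hz in K. congruence. }
    rewrite <- E. exact (nf_inj Hat V K).
Qed.

(** Both ends are carried to vertices 0 and 1 of another triangle; the label survives because it is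
    determined by the points. *)
Lemma edge_norm a u v :
  edge a u v -> exists pre t, chain (pre ++ [(t, I0)]) /\ tcomp t I2 = a /\
    isc u (pre ++ [(t, I0)]) /\ isc v (pre ++ [(t, I1)]).
Proof.
  intro H. pose proof H as (pre & t & i & j & C & _ & Hu & Hv).
  destruct (reachable_pair i j C) as (f & (pre' & s & C' & F) & <- & <-).
  pose proof (isc_equiv (F I0) Hu) as Hu'. pose proof (isc_equiv (F I1) Hv) as Hv'.
  exists pre', s. split; auto. split; auto.
  apply (@edge_fun _ _ u v); auto. exists pre', s, I0, I1. auto.
Qed.

(** S mentions only edges from vertex 0 to vertex 1. Every edge can be brought there by [edge_norm],
    and vertex 2 supplies the third point. *)
Lemma Srel_edge u v : Srel u v <-> exists a, edge a u v.
Proof.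
  split.
  - intros (w & t & p & Ht & Hp & (pre & k & ->) & Hu & Hv & _).
    rewrite set_last_app in Hu, Hv. exists (lab t I0 I1), pre, t, I0, I1.
    repeat split; auto. exact (chain_last I0 (proj2 Hp)).
  - intros (a & H). destruct (edge_norm H) as (pre & t & C & _ & Hu & Hv).
    destruct (isc_exists (app_trail (chain_last I2 C))) as (w & Hw).
    exists w, t, (pre ++ [(t, I0)]). rewrite !set_last_app.
    split; [exact (trail_inB C)|]. split; [exact (app_trail C)|].
    split; [now exists pre, I0|]. auto.
Qed.

Lemma edge_compose a b c u w :
  edge c u w -> cycle a b c -> exists v, edge a u v /\ edge b v w.
Proof.
  intros H K. destruct (edge_norm H) as (pre & t & C & E & Hu & Hw).
  (* A triangle glued to the edge from 0 to 1, whose vertex 2 is the required intermediate point. *)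
  set (s := (b˘, a, c) : T).
  assert (Hs : inB s).
  { apply cycle_rot in K. unfold inB, cycle in *. simpl. tauto. }
  assert (R : Trel I2 t s).
  { split; [exact (trail_inB C)|]. auto. }
  destruct (extend C R) as (pre' & C' & F).
  destruct (isc_exists (app_trail (chain_last I2 C'))) as (v & Hv).
  exists v. split.
  - exists pre', s, I0, I2. repeat split; auto.
    apply (isc_equiv (F I0 ltac:(discriminate)) Hu).
  - exists pre', s, I2, I1. repeat split; auto; [apply convK|].
    apply (isc_equiv (F I1 ltac:(discriminate)) Hw).
Qed.

Lemma edge_exists a : atom a -> exists u v, edge a u v.
Proof.
  (* A degenerate triangle in which vertices 1 and 2 coincide. *)
  intro Ha. set (t := (dom a˘, a, a) : T).
  assert (Ht : inB t).
  { pose proof (cycle_dom_r Hat Ha). unfold inB, cycle in *. simpl. tauto. }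
  assert (C : forall i, chain ([] ++ [(t, i)])) by (intro; exact Ht).
  destruct (isc_exists (app_trail (C I0))) as (u & Hu).
  destruct (isc_exists (app_trail (C I1))) as (v & Hv).
  exists u, v, [], t, I0, I1. auto.
Qed.

(* Deck transformation of the forest of reduced trails: it exchanges the trees rooted
   at the neighbours [t] and [s]. *)
Definition tau t s k p : trailseq W :=
  match p with
  | [] => []
  | (x, _) :: _ =>
      if excluded_middle_informative (x = t) then (s, k) :: p
      else if excluded_middle_informative (x = s) then (t, k) :: p
      else p
  end.

Lemma tau_l t s k i p : tau t s k ((t, i) :: p) = (s, k) :: (t, i) :: p.
Proof. simpl. now destruct excluded_middle_informative. Qed.

Lemma tau_r t s k i p : t <> s -> tau t s k ((s, i) :: p) = (t, k) :: (s, i) :: p.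
Proof.
  intro N. simpl. destruct excluded_middle_informative; [congruence|].
  now destruct excluded_middle_informative.
Qed.

Lemma tau_other t s k x i p : x <> t -> x <> s -> tau t s k ((x, i) :: p) = (x, i) :: p.
Proof.
  intros N M. simpl. destruct excluded_middle_informative; [congruence|].
  now destruct excluded_middle_informative.
Qed.

Lemma gen_cons e p q : is_trail (e :: p) -> is_trail (e :: q) -> gen p q ->
  gen (e :: p) (e :: q).
Proof.
  intros Hp Hq (_ & _ & G). split; [|split]; auto. destruct G as [G | [G | G]].
  - destruct G as (pre & t & l & s & k & post & -> & ->).
    left. exists (e :: pre), t, l, s, k, post. auto.
  - destruct G as (pre & t & l & s & n & N & -> & ->).
    right. left. exists (e :: pre), t, l, s, n. auto.
  - destruct G as (pre & t & l & k & G & -> & ->).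
    right. right. exists (e :: pre), t, l, k. auto.
Qed.

(** Since [tau] inspects only the first triangle, it treats both sides of a generator alike. *)
Lemma gen_head p q : gen p q ->
  exists t k k' p' q', p = (t, k) :: p' /\ q = (t, k') :: q'.
Proof.
  intros (_ & _ & [G | [G | G]]).
  - destruct G as ([|[x m] pre] & t & l & s & k & post & -> & ->); simpl; eauto 10.
  - destruct G as ([|[x m] pre] & t & l & s & n & N & -> & ->); simpl; eauto 10.
  - destruct G as ([|[x m] pre] & t & l & k & G & -> & ->); simpl; eauto 10.
Qed.

Lemma equiv_backtrack t l s k post :
  chain ((t, k) :: post) -> Trel l t s -> t <> s ->
  trail_equiv ((t, l) :: (s, l) :: (t, k) :: post) ((t, k) :: post).
Proof.
  intros C R N. pose proof (Trel_sym R) as R'. apply rst_step. split; [|split].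
  - split; [discriminate|].
    exact (conj (proj1 R) (conj N (conj R (conj (proj1 R') (conj (not_eq_sym N) (conj R' C)))))).
  - split; [discriminate | exact C].
  - left. exists [], t, l, s, k, post. auto.
Qed.

Section Tau.
Variables (t s : T) (k : idx).
Hypothesis (R : Trel k t s) (N : t <> s).

Let R' : Trel k s t := Trel_sym R.
Let N' : s <> t := fun E => N (eq_sym E).

Lemma tau_cases p : is_trail p -> exists x i r, p = (x, i) :: r /\
  (x = t /\ tau t s k p = (s, k) :: p \/
   x = s /\ tau t s k p = (t, k) :: p \/
   x <> t /\ x <> s /\ tau t s k p = p).
Proof.
  intros [Hn _]. destruct p as [|[x i] r]; [congruence|]. exists x, i, r. split; auto.
  destruct (classic (x = t)) as [-> |]; [left; split; auto; apply tau_l|].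
  destruct (classic (x = s)) as [-> |]; [right; left; split; auto; now apply tau_r|].
  right. right. split; [|split]; auto. now apply tau_other.
Qed.

Lemma tau_trail p : is_trail p -> is_trail (tau t s k p).
Proof.
  intro H. destruct (tau_cases H) as (x & i & r & -> & [[-> ->] | [[-> ->] | (_ & _ & ->)]]);
    auto; destruct H as [_ H]; (split; [discriminate|]); split; [apply R'| |apply R|];
    auto.
Qed.

Lemma tau_tau p : is_trail p -> trail_equiv (tau t s k (tau t s k p)) p.
Proof.
  intro H.
  destruct (tau_cases H) as (x & i & r & -> & [[-> ->] | [[-> ->] | (_ & _ & E)]]).
  - rewrite tau_r by auto. apply equiv_backtrack; auto. apply H.
  - rewrite tau_l. apply equiv_backtrack; auto. apply H.
  - rewrite !E. apply equiv_refl.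
Qed.

Lemma tau_gen p q : gen p q -> gen (tau t s k p) (tau t s k q).
Proof.
  intro G. pose proof G as (Hp & Hq & _).
  pose proof (tau_trail Hp) as Kp. pose proof (tau_trail Hq) as Kq.
  destruct (gen_head G) as (x & i & i' & p' & q' & -> & ->).
  destruct (classic (x = t)) as [-> |]; [rewrite !tau_l in *; now apply gen_cons|].
  destruct (classic (x = s)) as [-> |].
  - rewrite !tau_r in * by auto. now apply gen_cons.
  - now rewrite !tau_other.
Qed.

Lemma tau_equiv p q : trail_equiv p q -> trail_equiv (tau t s k p) (tau t s k q).
Proof.
  induction 1.
  - now apply rst_step, tau_gen.
  - apply equiv_refl.
  - now apply equiv_sym.
  - eapply equiv_trans; eauto.
Qed.

Lemma tau_app pre x : exists pre', forall i, tau t s k (pre ++ [(x, i)]) = pre' ++ [(x, i)].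
Proof.
  destruct (snoc_head pre x) as (y & m & K).
  destruct (classic (y = t)) as [-> |]; [|destruct (classic (y = s)) as [-> |]].
  - exists ((s, k) :: pre). intro i. destruct (K i) as (r & E).
    simpl. rewrite E. apply tau_l.
  - exists ((t, k) :: pre). intro i. destruct (K i) as (r & E).
    simpl. rewrite E. now apply tau_r.
  - exists pre. intro i. destruct (K i) as (r & E). rewrite E. now apply tau_other.
Qed.

(** The map [tau] changes only the start of a trail, so both ends stay vertices of the same final
    triangle. *)
Lemma edge_tau a u v u' v' p q :
  is_trail p -> is_trail q -> isc u p -> isc v q ->
  isc u' (tau t s k p) -> isc v' (tau t s k q) -> edge a u v -> edge a u' v'.
Proof.
  intros Hp Hq Hu Hv Hu' Hv' (pre & x & i & j & C & E & Ku & Kv).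
  destruct (tau_app pre x) as (pre' & F). exists pre', x, i, j. split; [|split; [|split]]; auto.
  - rewrite <- F. apply tau_trail, app_trail, C.
  - rewrite <- F. apply isc_equiv with (tau t s k p); auto.
    apply tau_equiv, (isc_unique (app_trail (chain_last i C)) Hu Ku).
  - rewrite <- F. apply isc_equiv with (tau t s k q); auto.
    apply tau_equiv, (isc_unique (app_trail (chain_last j C)) Hv Kv).
Qed.

End Tau.

(** The permutation of U induced by [tau] is expressed through representing trails, which avoids a
    map on classes. *)
Definition invariant (Q : rel_on U) :=
  forall t s k, Trel k t s -> t <> s ->
  forall p q u v u' v', is_trail p -> is_trail q -> isc u p -> isc v q ->
    isc u' (tau t s k p) -> isc v' (tau t s k q) -> (Q u v <-> Q u' v').

Lemma invariant_subalgebra : is_set_rel_subalgebra invariant.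
Proof.
  unfold is_set_rel_subalgebra, invariant. split; [|split; [|split; [|split]]].
  - intros Q S HQ HS t s k R N p q u v u' v' Hp Hq Hu Hv Hu' Hv'.
    now rewrite (HQ t s k R N p q u v u' v'), (HS t s k R N p q u v u' v').
  - intros Q HQ t s k R N p q u v u' v' Hp Hq Hu Hv Hu' Hv'.
    now rewrite (HQ t s k R N p q u v u' v').
  - intros Q S HQ HS t s k R N p q u v u' v' Hp Hq Hu Hv Hu' Hv'. split.
    + intros (w & H & K). destruct (isc_surj w) as (r & Hr & Hw).
      destruct (isc_exists (tau_trail R N Hr)) as (w' & Hw'). exists w'. split.
      * now rewrite <- (HQ t s k R N p r u w u' w').
      * now rewrite <- (HS t s k R N r q w v w' v').
    + intros (w' & H & K). destruct (isc_surj w') as (r & Hr & Hw').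
      destruct (isc_exists (tau_trail R N Hr)) as (w & Hw). exists w.
      (* Up to equivalence [tau] is an involution, so [w] is the preimage of [w']. *)
      assert (isc w' (tau t s k (tau t s k r))).
      { apply isc_equiv with r; auto. apply equiv_sym, tau_tau; auto. }
      pose proof (tau_trail R N Hr). split.
      * now rewrite (HQ t s k R N p (tau t s k r) u w u' w').
      * now rewrite (HS t s k R N (tau t s k r) q w v w' v').
  - intros Q HQ t s k R N p q u v u' v' Hp Hq Hu Hv Hu' Hv'.
    exact (HQ t s k R N q p v u v' u' Hq Hp Hv Hu Hv' Hu').
  - intros t s k R N p q u v u' v' Hp Hq Hu Hv Hu' Hv'. split; intros <-.
    + apply (isc_inj Hu'). apply isc_equiv with (tau t s k q); auto.
      apply tau_equiv; auto. exact (isc_unique Hp Hv Hu).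
    + pose proof (tau_equiv R N (isc_unique (tau_trail R N Hq) Hu' Hv')) as E.
      apply (isc_inj Hu). apply isc_equiv with q; [|exact Hv].
      eapply equiv_trans; [|eapply equiv_trans; [apply equiv_sym, E|]].
      * apply equiv_sym, tau_tau; auto.
      * apply tau_tau; auto.
Qed.

Lemma invariant_edges (X : A -> Prop) :
  invariant (fun u v => exists a, X a /\ edge a u v).
Proof.
  intros t s k R N p q u v u' v' Hp Hq Hu Hv Hu' Hv'.
  split; intros (a & Ha & E); exists a; split; auto.
  - apply (edge_tau R N Hp Hq Hu Hv Hu' Hv' E).
  - apply (edge_tau R N (tau_trail R N Hp) (tau_trail R N Hq) Hu' Hv' (u' := u) (v' := v));
      auto.
    + apply isc_equiv with p; auto. apply equiv_sym, tau_tau; auto.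
    + apply isc_equiv with q; auto. apply equiv_sym, tau_tau; auto.
Qed.

(** If a trail starts with neighbours [t0], [t1], the matching [tau] prepends [t1]; the backtrack
    cancels and the trail has lost its first step. Induction reduces it to its last triangle. *)
Lemma invariant_root Q pre t i j u v u' v' :
  invariant Q -> chain (pre ++ [(t, I0)]) ->
  isc u (pre ++ [(t, i)]) -> isc v (pre ++ [(t, j)]) ->
  isc u' [(t, i)] -> isc v' [(t, j)] -> (Q u v <-> Q u' v').
Proof.
  intros HQ. revert u v. induction pre as [|[t0 k] pre IH]; intros u v C Hu Hv Hu' Hv'.
  - now rewrite (isc_inj Hu Hu'), (isc_inj Hv Hv').
  - destruct (snoc_head pre t) as (t1 & m & K).
    assert (D : forall i, chain (((t0, k) :: pre) ++ [(t, i)]))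
      by (intro; exact (chain_last _ C)).
    assert (B : forall i, chain (pre ++ [(t, i)]) /\ t0 <> t1 /\ Trel k t0 t1 /\
              trail_equiv (tau t0 t1 k (((t0, k) :: pre) ++ [(t, i)])) (pre ++ [(t, i)])).
    { intro n. pose proof (D n) as Dn. destruct (K n) as (r & E).
      simpl app in *. rewrite E in *. destruct Dn as (_ & N & R & Dr).
      repeat (split; auto). rewrite tau_l. apply equiv_backtrack; auto.
      now apply Trel_sym. }
    destruct (B i) as (Ci & N & R & Ei). destruct (B j) as (Cj & _ & _ & Ej).
    destruct (isc_exists (app_trail Ci)) as (u1 & Hu1).
    destruct (isc_exists (app_trail Cj)) as (v1 & Hv1).
    rewrite (HQ t0 t1 k R N _ _ u v u1 v1 (app_trail (D i)) (app_trail (D j)) Hu Hv).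
    + apply IH; auto. exact (chain_last I0 Ci).
    + exact (isc_equiv (equiv_sym Ei) Hu1).
    + exact (isc_equiv (equiv_sym Ej) Hv1).
Qed.

Lemma invariant_edge Q a u v u' v' :
  invariant Q -> edge a u v -> edge a u' v' -> Q u v -> Q u' v'.
Proof.
  intros HQ H H'.
  destruct (edge_norm H) as (pre & t & C & E & Hu & Hv).
  destruct (edge_norm H') as (pre' & t' & C' & E' & Hu' & Hv').
  assert (Ht := trail_inB C). assert (Ht' := trail_inB C').
  assert (D : forall (x : T) i, inB x -> is_trail [(x, i)]) by (split; [discriminate | auto]).
  destruct (isc_exists (D t I0 Ht)) as (u0 & Hu0).
  destruct (isc_exists (D t I1 Ht)) as (v0 & Hv0).
  destruct (isc_exists (D t' I0 Ht')) as (u1 & Hu1).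
  destruct (isc_exists (D t' I1 Ht')) as (v1 & Hv1).
  rewrite (invariant_root HQ C Hu Hv Hu0 Hv0), (invariant_root HQ C' Hu' Hv' Hu1 Hv1).
  (* Both triangles carry [a] on the edge opposite vertex 2, so a trail from [t] to [t'] keeps the
     ends of that edge and can be shortened to the root [t']. *)
  assert (R : Trel I2 t t') by (split; [|split]; congruence).
  assert (C0 : chain ([] ++ [(t, I0)])) by exact Ht.
  destruct (extend C0 R) as (pre1 & C1 & F).
  pose proof (isc_equiv (F I0 ltac:(discriminate)) Hu0) as Ku.
  pose proof (isc_equiv (F I1 ltac:(discriminate)) Hv0) as Kv.
  now rewrite (invariant_root HQ C1 Ku Kv Hu1 Hv1).
Qed.

Definition represent x : rel_on U := fun u v => exists a, a <= x /\ edge a u v.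

Lemma represent_iso (Hcompl : wcomplete W) : @is_iso_relativ W U invariant (@Srel W) represent.
Proof.
  unfold is_iso_relativ, rel_eq, represent.
  assert (LS : forall a u v, edge a u v -> Srel u v) by (intros; apply Srel_edge; eauto).
  split; [|split; [|split; [|split; [|split; [|split; [|split]]]]]].
  - intro x. exists (represent x). split; [apply invariant_edges|].
    intros u v. split; [intros (a & H & E); split; eauto; now exists a | tauto].
  - intros X (Q & HQ & HX).
    destruct (Hcompl (fun a => atom a /\ exists u v, edge a u v /\ Q u v)) as (x & Hub & Hlub).
    exists x. intros u v. rewrite (HX u v). split.
    + intros (a & Hle & E). split; eauto. apply NNPP. intro NQ.
      (* If [Q] fails on one edge labelled [a], it fails on all by invariance. Then the complement
         of [a] bounds all labels used by [Q], hence bounds [x]. *)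
      apply (atom_not_le_compl (edge_atom E) (le_refl a)). apply (le_trans Hle).
      { apply Hlub. intros b (Hb & u' & v' & E' & H').
        destruct (atom_le_or_compl a Hb) as [L|L]; auto.
        exfalso. apply NQ. rewrite (atom_le_eq Hb (edge_atom E) L) in E'.
        exact (invariant_edge HQ E' E H'). }
    + intros [HR HS]. apply Srel_edge in HS. destruct HS as (a & E).
      exists a. split; auto. apply Hub. split; [exact (edge_atom E) | eauto].
  - assert (H : forall x y, (forall u v, (exists a, a <= x /\ edge a u v) ->
                exists a, a <= y /\ edge a u v) -> x <= y).
    { intros x y H. apply (le_by_atoms Hat). intros a Ha Hx.
      destruct (edge_exists Ha) as (u & v & E).
      destruct (H u v) as (b & Hb & F); eauto. now rewrite (edge_fun E F). }
    intros x y E. apply le_antisym; apply H; intros u v; apply E.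
  - intros x y u v. split.
    + intros (a & H & E). split; eauto.
      destruct (atom_le_plus (edge_atom E) H); [left | right]; eauto.
    + intros [[(a & H & E) | (a & H & E)] _]; exists a; split; auto;
        eapply le_trans; eauto using le_plus_l, le_plus_r.
  - intros x u v. split.
    + intros (a & H & E). split; eauto. intros (b & K & F).
      rewrite (edge_fun F E) in K. exact (atom_not_le_compl (edge_atom E) K H).
    + intros [NE HS]. apply Srel_edge in HS. destruct HS as (a & E). exists a. split; auto.
      destruct (atom_le_or_compl x (edge_atom E)); auto. destruct NE. eauto.
  - intros x y u w. split.
    + intros (c & H & E). split; eauto.
      destruct (semi_atoms Hat (edge_atom E) H) as (a & b & Ha & Hb & Hx & Hy & K).
      destruct (@edge_compose a b c u w E) as (v & Ea & Eb).
      { unfold cycle. eauto using edge_atom. }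
      exists v. split; eauto.
    + intros [(v & (a & Hx & Ea) & (b & Hy & Eb)) HS].
      apply Srel_edge in HS. destruct HS as (c & E). exists c. split; auto.
      destruct (edge_cycle Ea Eb E) as (_ & _ & _ & K).
      eapply le_trans; [exact K | now apply semi_le].
  - intros x u v. split.
    + intros (a & H & E). split; eauto. exists a˘. split; [|now apply edge_conv].
      apply conv_le in H. now rewrite convK in H.
    + intros [(a & H & E) _]. exists a˘. split; [now apply conv_le | now apply edge_conv].
  - intros u v. split.
    + intros (a & H & E). split; eauto. now apply (edge_id E).
    + intros [H HS]. apply Srel_edge in HS. destruct HS as (a & E). exists a.
      split; auto. now apply (edge_id E).
Qed.

End Trails.

Theorem theorem7 (W : WA) (Hcompl : wcomplete W) (Hatomic : watomic W) :
  exists Ap : rel_on (Ucls W) -> Prop,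
    is_set_rel_subalgebra Ap /\
    exists f : car W -> rel_on (Ucls W), @is_iso_relativ W (Ucls W) Ap (@Srel W) f.
Proof.
  exists (@invariant W). split; [apply invariant_subalgebra|].
  exists (@represent W). now apply represent_iso.
Qed.
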